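(* Let $p\geq 7$ be a prime number. Consider the left braces, up to isomorphism, with additive group $\mathbf{Z}_p\times\mathbf{Z}_6\times\mathbf{Z}_2$ and multiplicative group a semidirect product $\mathbf{Z}_p\rtimes A_4$. 1) If $p\not\equiv 1\pmod 3$ there is just one such brace, which is a direct product. 2) If $p\equiv 1\pmod 3$ there are 2 such braces. One is a direct product and the second one has kernel isomorphic to $V_4$.
   Context: A left brace is a set $B$ with operations $+,\cdot$ such that $(B,+)$ is an abelian group (additive group), $(B,\cdot)$ is a group (multiplicative group), and $a(b+c)=ab-a+ac$ for all $a,b,c\in B$. Isomorphisms are bijections preserving both operations. $\mathbf{Z}_m=\mathbf{Z}/m\mathbf{Z}$, $A_4$ is the alternating group on four letters, and $V_4$ is the Klein four-group. Given a left brace $B'$ of size 12 with multiplicative group $F$ and a group morphism $\tau:F\to\mathrm{Aut}(\mathbf{Z}_p)\simeq\mathbf{Z}_p^*$, the semidirect product of the trivial brace $\mathbf{Z}_p$ (with $a\cdot b=a+b$) and $B'$ via $\tau$ is $\mathbf{Z}_p\times B'$ with componentwise addition and $(a,b)\cdot(a',b')=(a+\tau(b)a',bb')$; it is the direct product of braces when $\tau$ is trivial. For $p\geq 7$ every left brace of size $12p$ is isomorphic to one of this form. The kernel of the brace means $\ker\tau\subseteq F$. ''Multiplicative group $\mathbf{Z}_p\rtimes F$'' means isomorphic to $\mathbf{Z}_p\rtimes_\tau F$ for some $\tau$, possibly trivial. *)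

(* Defs.v *)
From HB Require Import structures.
From mathcomp Require Import all_boot all_order all_algebra.
From mathcomp Require Import all_fingroup all_solvable.

Set Implicit Arguments.
Unset Strict Implicit.
Unset Printing Implicit Defensive.

Import GRing.Theory.
Local Open Scope group_scope.
Local Open Scope ring_scope.

HB.mixin Record isLeftBrace B of GRing.Zmodule B & monoid.Group B := {
  brace_mulgDr : forall a b c : B,
    (a * (b + c))%g = (a * b)%g - a + (a * c)%g
}.

#[short(type="leftBraceType")]
HB.structure Definition LeftBrace :=
  {B of isLeftBrace B & GRing.Zmodule B & monoid.Group B}.

#[short(type="finLeftBraceType")]
HB.structure Definition FinLeftBrace := {B of LeftBrace B & Finite B}.

Definition brace_isomorphic (A B : leftBraceType) : Prop :=
  exists f : A -> B,
    [/\ bijective f, {morph f : x y / x + y} & {morph f : x y / (x * y)%g}].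

Definition additive_isomorphic (V W : zmodType) : Prop :=
  exists2 f : V -> W, bijective f & {morph f : x y / x + y}.

(* The semidirect product of 'Z_m and F via tau, where Aut('Z_m) is           *)
(* identified with the group of units of the ring 'Z_m. It is a type alias    *)
(* because 'Z_m * F already carries the direct product group structure.       *)
Definition Zsdprod m (F : finGroupType)
    (tau : {morphism [set: F] >-> {unit 'Z_m}}) : Type := ('Z_m * F)%type.

Section ZsdprodGroup.
Variables (m : nat) (F : finGroupType).
Variable tau : {morphism [set: F] >-> {unit 'Z_m}}.
Local Notation T := (Zsdprod tau).
Implicit Types x y z : T.

HB.instance Definition _ := Finite.copy T ('Z_m * F)%type.

Definition Zsdprod_mul x y : T := (x.1 + val (tau x.2) * y.1, (x.2 * y.2)%g).
Definition Zsdprod_one : T := (0, 1%g).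
Definition Zsdprod_inv x : T := (- (val (tau x.2^-1%g) * x.1), x.2^-1%g).

Fact Zsdprod_mulA : associative Zsdprod_mul.
Proof.
move=> x y z; congr (_, _); rewrite /= ?mulgA //.
by rewrite morphM ?inE //= mulrDr addrA mulrA.
Qed.

Fact Zsdprod_mul1 : left_id Zsdprod_one Zsdprod_mul.
Proof. by move=> [a b]; rewrite /Zsdprod_mul /= morph1 add0r mul1r mul1g. Qed.

Fact Zsdprod_mulV : left_inverse Zsdprod_one Zsdprod_inv Zsdprod_mul.
Proof. by move=> x; rewrite /Zsdprod_mul /= addNr mulVg. Qed.

HB.instance Definition _ :=
  Finite_isGroup.Build T Zsdprod_mulA Zsdprod_mul1 Zsdprod_mulV.
End ZsdprodGroup.

Section ZsdprodBrace.
Variables (m : nat) (B : finLeftBraceType).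
Variable tau : {morphism [set: B] >-> {unit 'Z_m}}.
Local Notation T := (Zsdprod tau).

HB.instance Definition _ := GRing.Zmodule.copy T ('Z_m * B)%type.

Fact Zsdprod_mulgDr (x y z : T) :
  (x * (y + z))%g = (x * y)%g - x + (x * z)%g.
Proof.
congr (_, _) => /=; last exact: brace_mulgDr.
rewrite mulrDr; set a := x.1; set b := _ * y.1; set c := _ * z.1.
by rewrite [a + b]addrC addrK addrCA.
Qed.

HB.instance Definition _ := isLeftBrace.Build T Zsdprod_mulgDr.
End ZsdprodBrace.

Definition A4 : finGroupType := [subg 'Alt_('I_4)]%type.
(* The group law of 'Z_2 is its addition.                                     *)
Definition V4 : finGroupType := ('Z_2 * 'Z_2)%type.

Definition add_Zp62_mul_ZpA4 p (B : finLeftBraceType) : Prop :=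
  additive_isomorphic B ('Z_p * 'Z_6 * 'Z_2)%type /\
  exists tau : {morphism [set: A4] >-> {unit 'Z_p}},
    [set: B] \isog [set: Zsdprod tau].

Definition is_direct_product p (B : finLeftBraceType) : Prop :=
  exists (B' : finLeftBraceType) (tau : {morphism [set: B'] >-> {unit 'Z_p}}),
    [/\ #|B'| = 12%N, brace_isomorphic B (Zsdprod tau)
      & forall b, tau b = 1%g].

Definition has_kernel p (B : finLeftBraceType) (K : finGroupType) : Prop :=
  exists (B' : finLeftBraceType) (tau : {morphism [set: B'] >-> {unit 'Z_p}}),
    [/\ #|B'| = 12%N, brace_isomorphic B (Zsdprod tau)
      & 'ker tau \isog [set: K]].

(* Main.v *)
Require Import Defs.
From HB Require Import structures.
From mathcomp Require Import all_boot all_order all_algebra.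
From mathcomp Require Import all_fingroup all_solvable.

Set Implicit Arguments.
Unset Strict Implicit.
Unset Printing Implicit Defensive.

Import GRing.Theory.
Local Open Scope group_scope.
Local Open Scope ring_scope.

(** A left brace B carries the action lam b y = b * y - b of its
multiplicative group on its additive group by automorphisms, and
b * y = b + lam b y, so that B is determined by its additive group together
with this action.  Here the additive group is P + V + C with P, V, C of orders
p, 4 and 3; each of them is a torsion subgroup, hence stable under every
lam b.

Two facts on the multiplicative group G = Z_p : A4 suffice to determine the
action: G has no subgroup of index 2, and in G a nontrivial element of square
1 never commutes with a nontrivial element of cube 1 ([Zsdprod_no_index2],
[Zsdprod_no_order6]).  By the first one C is fixed pointwise
([lam_fixes_c]), and every lam b acts on V as an even permutation, hence
either trivially or as a 3-cycle of the nonzero elements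
([lam_V_id_or_fpf]).  If v in V acted nontrivially on V, then v * lam v v
would be lam v v, so that v would be the identity; the same fixed-point
argument shows that P acts trivially on P, and comparing orders shows that P
acts trivially on V.  By the second fact a generator c of C acts nontrivially
on V, since otherwise c would commute with an involution.  Finally the
character through which V acts on P is invariant under conjugation by c, which
permutes the nonzero elements of V cyclically, so it is trivial ([lam_V_fixes_x]).  Thus the action factors through C, where c acts on
V as multiplication by a primitive cube root of unity of the field with four
elements, and on P as multiplication by some zeta with zeta^3 = 1.

This says that B is the semidirect product [model] of Z_p and the brace
F_4 : Z_3 of size 12 ([brace_iso_model]).  Replacing c by 2c replaces zeta by
zeta^2, so that only the order of zeta matters ([class_normal_form]).  If 3
does not divide p - 1, then zeta = 1 and B is a direct product.  Otherwise
there is exactly one further brace, with zeta of order 3; it differs from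
the direct product by the action on the p-torsion ([model_not_iso]), and its
kernel is V ([model_kernel]). *)

(** * The brace of size 12 *)

Lemma iter_modn (T : Type) (g : T -> T) y n m :
  iter n g y = y -> iter (m %% n) g y = iter m g y.
Proof.
move=> gn; rewrite {2}(divn_eq m n) addnC iterD; congr (iter _ _ _).
by elim: (m %/ n)%N => // q; rewrite mulSn iterD => <-.
Qed.

(** Multiplication by a primitive cube root of unity in the field with four
elements, on the basis (1, omega). *)
Definition omega (v : 'Z_2 * 'Z_2) : 'Z_2 * 'Z_2 := (v.2, v.1 + v.2).

Lemma omegaD : {morph omega : v w / v + w}.
Proof. by move=> v w; congr (_, _); rewrite /= addrACA. Qed.

Lemma Z2_addxx (s : 'Z_2) : s + s = 0.
Proof. by case: s => [[|[|//]] ?]; apply: val_inj. Qed.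

Lemma omega2E v : omega (omega v) = v + omega v.
Proof. by case: v => s t; congr (_, _); rewrite /= addrC. Qed.

Lemma V_addxx (v : 'Z_2 * 'Z_2) : v + v = 0.
Proof. by case: v => s t; congr (_, _); apply: Z2_addxx. Qed.

Lemma omega3 v : omega (omega (omega v)) = v.
Proof. by rewrite omega2E omega2E addrCA V_addxx addr0. Qed.

Lemma omega_fix v : omega v = v -> v = 0.
Proof. by move=> vv; have := omega2E v; rewrite !vv V_addxx. Qed.

Lemma iter_omegaD i : {morph iter i omega : v w / v + w}.
Proof. by elim: i => // i IHi v w; rewrite !iterS IHi omegaD. Qed.

Lemma iter_omega0 i : iter i omega 0 = 0.
Proof. by elim: i => // i IHi; rewrite iterS IHi /omega addr0. Qed.

Lemma iter_omega_mod i v : iter (i %% 3) omega v = iter i omega v.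
Proof. by apply: iter_modn; apply: omega3. Qed.

Lemma iter_omegaZ3 (i j : 'Z_3) v :
  iter (i + j)%R omega v = iter i omega (iter j omega v).
Proof. by rewrite -iterD -[RHS]iter_omega_mod. Qed.

(** An alias, since the product type already carries the direct product group
structure. *)
Definition B12 : Type := ('Z_2 * 'Z_2 * 'Z_3)%type.

HB.instance Definition _ := Finite.copy B12 ('Z_2 * 'Z_2 * 'Z_3)%type.

Definition B12_mul (x y : B12) : B12 := (x.1 + iter x.2 omega y.1, x.2 + y.2).
Definition B12_one : B12 := (0, 0).
Definition B12_inv (x : B12) : B12 := (iter (- x.2) omega (- x.1), - x.2).

Fact B12_mulA : associative B12_mul.
Proof.
move=> x y z; congr (_, _); last exact: addrA.
by rewrite /= iter_omegaD iter_omegaZ3 addrA.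
Qed.

Fact B12_mul1 : left_id B12_one B12_mul.
Proof. by move=> [v i]; congr (_, _); rewrite /= add0r. Qed.

Fact B12_mulV : left_inverse B12_one B12_inv B12_mul.
Proof.
move=> x; congr (_, _); last exact: addNr.
rewrite /= -iter_omegaD addNr.
exact: iter_omega0.
Qed.

HB.instance Definition _ :=
  Finite_isGroup.Build B12 B12_mulA B12_mul1 B12_mulV.

HB.instance Definition _ := GRing.Zmodule.copy B12 ('Z_2 * 'Z_2 * 'Z_3)%type.

Fact B12_mulgDr (x y z : B12) :
  (x * (y + z))%g = (x * y)%g - x + (x * z)%g.
Proof.
congr (_, _) => /=.
  by rewrite iter_omegaD [x.1 + iter _ _ y.1]addrC addrK addrCA.
by rewrite [x.2 + y.2]addrC addrK addrCA.
Qed.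

HB.instance Definition _ := isLeftBrace.Build B12 B12_mulgDr.

Lemma card_B12 : #|{: B12}| = 12%N.
Proof. by rewrite !card_prod !card_ord. Qed.

Lemma mulB12E (x y : B12) :
  (x * y)%g = (x.1 + iter x.2 omega y.1, x.2 + y.2).
Proof. by []. Qed.

Definition cube_trivial (gT : groupType) (x : gT) := (x * (x * x))%g = 1%g.

(** 1 + omega + omega^2 = 0. *)
Lemma B12_cube (x : B12) : x.2 != 0 -> cube_trivial x.
Proof.
rewrite /cube_trivial; case: x => v [[|[|[|//]]] ?] //= _; rewrite !mulB12E /=;
  congr (_, _); rewrite /=; try (by apply: val_inj);
  rewrite ?omegaD ?omega3 omega2E; set w := omega v.
- by rewrite addrA V_addxx.
- by rewrite addrA addrA V_addxx add0r V_addxx.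
Qed.

(** The use of this generation property is that a homomorphism to a group of
order 2 kills every element of cube 1. *)
Lemma B12_cubes (x : B12) :
  exists y z : B12, [/\ x = (y * z)%g, cube_trivial y & cube_trivial z].
Proof.
have [x2|x2] := eqVneq x.2 0; last first.
  by exists x, 1%g; split; rewrite /cube_trivial ?mulg1 //; apply: B12_cube.
exists (x.1, 1), (0, -1); split; try exact: B12_cube.
by case: x x2 => v i /= ->; rewrite mulB12E [iter _ _ _]iter_omega0 addr0 subrr.
Qed.

(** * The multiplicative group of that brace is A4 *)

Lemma bool_hom_cube (gT : groupType) (s : gT -> bool) x :
  {morph s : x y / (x * y)%g >-> x (+) y} -> cube_trivial x -> s x = false.
Proof.
move=> sM x3; have := sM 1%g 1%g; rewrite mulg1 -x3 !sM.
by case: (s x).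
Qed.

(** F_4 : Z_3 acts on the affine line F_4 by v |-> a + omega^i v; this is the
classical identification with the alternating group on four points. *)
Definition affine (x : B12) v := x.1 + iter x.2 omega v.

Lemma affineM x y v : affine (x * y)%g v = affine x (affine y v).
Proof. by rewrite /affine /= iter_omegaD iter_omegaZ3 addrA. Qed.

Lemma affine1 v : affine 1%g v = v.
Proof. by rewrite -[LHS]/(0 + v) add0r. Qed.

Lemma affine_faithful x : affine x =1 id -> x = 1%g.
Proof.
move=> xid; have := xid 0; have := xid (1, 0); case: x {xid} => v i.
rewrite /affine /= iter_omega0 addr0 => + v0; rewrite v0 add0r.
by case: i => [[|[|[|//]]] ?] //= _; congr (_, _); apply: val_inj.
Qed.

(** The affine action is faithful and even, the latter because the group is
generated by elements of cube 1; both groups have order 12. *)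
Lemma B12_A4 : exists2 h : A4 -> B12, bijective h & {morph h : x y / (x * y)%g}.
Proof.
have [g [g' gK g'K]] : exists g : 'I_4 -> 'Z_2 * 'Z_2, bijective g.
  have V4card : #|{: 'Z_2 * 'Z_2}| = 4%N by rewrite card_prod !card_ord.
  exists (fun i => enum_val (cast_ord (esym V4card) i)).
  exists (fun v => cast_ord V4card (enum_rank v)) => x.
    by rewrite enum_valK cast_ordKV.
  by rewrite cast_ordK enum_rankK.
(* The product of permutations composes from left to right, hence the
   inverse. *)
have act_inj x : injective (fun i => g' (affine x^-1%g (g i))).
  apply: (@can_inj _ _ _ (fun i => g' (affine x (g i)))) => i.
  by rewrite g'K -affineM mulgV affine1 gK.
pose k x := perm (@act_inj x).
have kM : {morph k : x y / (x * y)%g}.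
  by move=> x y; apply/permP=> i; rewrite permM !permE g'K invgM affineM.
have k_even x : k x \in 'Alt_('I_4).
  have sM : {morph (fun x => odd_perm (k x)) : x y / (x * y)%g >-> x (+) y}.
    by move=> y z; rewrite kM odd_permM.
  rewrite Alt_even;
    have [y [z [-> /(bool_hom_cube sM) + /(bool_hom_cube sM)]]] := B12_cubes x.
  by rewrite kM odd_permM => -> ->.
pose f x : A4 := subg 'Alt_('I_4) (k x).
have fM : {morph f : x y / (x * y)%g}.
  move=> x y; rewrite /f kM; apply: (can_inj (@sgvalK _ _)).
  by rewrite sgvalM ?in_setT // !subgK // -kM.
have f_inj : injective f.
  move=> x y /(congr1 sgval); rewrite !subgK // => kxy.
  have k1 : k (y^-1 * x)%g = k 1%g by rewrite kM kxy -kM mulVg.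
  suff: (y^-1 * x)%g = 1%g by move/(canRL (mulKVg y)); rewrite mulg1.
  apply: invg_inj; rewrite invg1; apply: affine_faithful => v.
  by have /permP/(_ (g' v)) := k1;
    rewrite !permE invg1 affine1 g'K => /(can_inj g'K).
have cardA4 : (#|{: A4}| <= #|{: B12}|)%N.
  have := card_Alt (T := 'I_4); rewrite card_ord => /(_ isT) A.
  rewrite card_B12 -(leq_pmul2l (isT : 0 < 2)%N) -[(2 * 12)%N]A.
  by rewrite card_sub leq_pmul2l // subset_leq_card //; apply/subsetP=> x.
have [h fK hK] := inj_card_bij f_inj cardA4.
exists h; first by exists f.
by move=> x y; apply: (can_inj fK); rewrite fM !hK.
Qed.

(** * Two properties of the multiplicative groups *)

(** Signs valued in bool with exclusive or, the form in which [odd_perm] is a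
homomorphism. *)
Definition no_index2 (gT : groupType) :=
  forall s : gT -> bool,
    {morph s : x y / (x * y)%g >-> x (+) y} -> forall x, s x = false.

Definition no_order6 (gT : groupType) :=
  forall x y : gT, (x * x)%g = 1%g -> cube_trivial y ->
    (x * y)%g = (y * x)%g -> x = 1%g \/ y = 1%g.

Lemma gmorph1 (gT hT : groupType) (f : gT -> hT) :
  {morph f : x y / (x * y)%g} -> f 1%g = 1%g.
Proof.
by move=> fM; apply: (mulIg (f 1%g)); rewrite -fM !mul1g.
Qed.

Lemma no_index2_iso (gT hT : groupType) (f : gT -> hT) :
  bijective f -> {morph f : x y / (x * y)%g} -> no_index2 hT -> no_index2 gT.
Proof.
move=> [g fK gK] fM hT2 s sM x.
rewrite -[x]fK; apply: (hT2 (s \o g)) => y z /=.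
by rewrite -sM; congr s; apply: (can_inj fK); rewrite fM !gK.
Qed.

Lemma no_order6_inj (gT hT : groupType) (f : gT -> hT) :
  injective f -> {morph f : x y / (x * y)%g} -> no_order6 hT -> no_order6 gT.
Proof.
move=> fI fM hT6 x y x2 y3 xy; have f1 := gmorph1 fM.
case: (hT6 (f x) (f y)) => [|||fx|fy];
  rewrite /cube_trivial -?fM ?x2 ?y3 ?xy //.
- by left; apply: fI; rewrite fx.
- by right; apply: fI; rewrite fy.
Qed.

Lemma B12_no_index2 : no_index2 B12.
Proof.
move=> s sM x; have [y [z [-> y3 z3]]] := B12_cubes x.
by rewrite sM !(bool_hom_cube sM).
Qed.

(** Outside V, conjugation acts on V as a nontrivial power of omega, which has
no nonzero fixed point. *)
Lemma B12_no_order6 : no_order6 B12.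
Proof.
move=> [v i] [w j] /(congr1 snd) /= ii.
have {ii i}-> : i = 0.
  by case: i ii => [[|[|[|//]]] ?] // _; apply: val_inj.
move=> w3 /(congr1 fst) /=; rewrite addrC => /addrI.
have [j0|j0] := eqVneq j 0; last first.
  move=> vE; left; congr (_, _).
  apply: omega_fix; case: j j0 {w3} vE => [[|[|[|//]]] ?] //= _ vE.
  by rewrite {1}vE omega3.
move=> _; right; move: w3; rewrite j0 => /(congr1 fst) /=.
by rewrite V_addxx addr0 => ->.
Qed.

Lemma A4_no_index2 : no_index2 A4.
Proof.
by have [h hb hM] := B12_A4; apply: no_index2_iso hb hM B12_no_index2.
Qed.

Lemma A4_no_order6 : no_order6 A4.
Proof.
by have [h /bij_inj hI hM] := B12_A4; apply: no_order6_inj hI hM B12_no_order6.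
Qed.

Lemma Zp_mulrn_char p (a : 'Z_p) : (1 < p)%N -> a *+ p = 0.
Proof. by move=> p1; rewrite -mulr_natr pchar_Zp ?mulr0. Qed.

Section Zsdprod.
Variables (p : nat) (F : finGroupType).
Variable tau : {morphism [set: F] >-> {unit 'Z_p}}.
Hypotheses (p_gt1 : (1 < p)%N) (p_odd : odd p).

Lemma mulZsdprodE (x y : Zsdprod tau) :
  (x * y)%g = (x.1 + val (tau x.2) * y.1, (x.2 * y.2)%g).
Proof. by []. Qed.

(** As p is odd, the elements of Z_p are squares, so a sign is trivial on them
and is determined by its restriction to F. *)
Lemma Zsdprod_no_index2 : no_index2 F -> no_index2 (Zsdprod tau).
Proof.
move=> F2 s sM [a g].
have tau1 : tau 1%g = 1%g by apply: morph1.
(* Half of a modulo p. *)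
pose b := a *+ p.+1./2.
have bb : b + b = a.
  rewrite -mulrnDr addnn -[RHS]addr0 -(Zp_mulrn_char a p_gt1) -mulrS.
  by rewrite -{2}[p.+1]odd_double_half /= p_odd.
pose b1 : Zsdprod tau := (b, 1%g); pose g0 : Zsdprod tau := (0, g).
have -> : (a, g) = (b1 * b1 * g0)%g :> Zsdprod tau.
  by rewrite !mulZsdprodE /= mulr0 addr0 tau1 mul1r bb !mul1g.
rewrite !sM addbb /=; apply: (F2 (fun g => s (0, g))) => x y.
by rewrite -sM mulZsdprodE /= mulr0 addr0.
Qed.

(** An element of square or cube 1 with trivial image in F lies in Z_p, so it is
trivial, as p is prime to 6. *)
Lemma Zsdprod_no_order6 : coprime p 3 -> no_order6 F -> no_order6 (Zsdprod tau).
Proof.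
move=> p3 F6 [a g] [b h] ag2 bh3 comm.
have tau1 : tau 1%g = 1%g by apply: morph1.
have key n (c : 'Z_p) : coprime p n -> c *+ n = 0 -> c = 0.
  move=> co; rewrite -mulr_natr => cn;
    rewrite -[c](mulrK (x := n%:R)) ?cn ?mul0r //.
  by rewrite unitZpE.
case: (F6 g h); rewrite /cube_trivial.
- exact: (congr1 snd ag2).
- exact: (congr1 snd bh3).
- exact: (congr1 snd comm).
- move=> g1; left; congr (_, _) => //; apply: (key 2).
    by rewrite coprimen2.
  by have := congr1 fst ag2; rewrite /= g1 tau1 mul1r.
- move=> h1; right; congr (_, _) => //; apply: (key 3) => //.
  by have := congr1 fst bh3; rewrite /= h1 tau1 !mul1r.
Qed.
End Zsdprod.

Lemma isog_bij (gT hT : finGroupType) :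
  [set: gT] \isog [set: hT] <->
  exists2 f : gT -> hT, bijective f & {morph f : x y / (x * y)%g}.
Proof.
split=> [/isogP[f finj fim]|[f fb fM]].
  exists f; last by move=> x y; rewrite morphM ?inE.
  apply: inj_card_bij => [x y|]; first by apply: (injmP finj); rewrite inE.
  by rewrite -!cardsT -fim card_injm.
pose F := Morphism (in2W fM : {in [set: gT] &, {morph f : x y / (x * y)%g}}).
apply/isogP; exists F.
  by apply/injmP; apply: in2W; apply: bij_inj fb.
by apply/setP=> y; case: fb => g fK gK; rewrite inE; apply/morphimP;
  exists (g y); rewrite ?inE ?gK.
Qed.

(** * The lambda action *)

Section Lambda.
Variable B : leftBraceType.
Implicit Types a b c y z : B.

Definition lam b y := (b * y)%g - b.

Lemma brace_mulE b y : (b * y)%g = b + lam b y.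
Proof. by rewrite /lam addrC subrK. Qed.

Lemma brace_one : 1%g = 0 :> B.
Proof.
have := brace_mulgDr (1%g : B) 0 0; rewrite !mul1g !addr0 sub0r => /eqP.
by rewrite eq_sym oppr_eq0 => /eqP.
Qed.

Lemma lamD b : {morph lam b : y z / y + z}.
Proof. by move=> y z; rewrite /lam brace_mulgDr -!addrA. Qed.

Lemma lam0 b : lam b 0 = 0.
Proof. by rewrite -{1}brace_one /lam mulg1 subrr. Qed.

Lemma lamN b : {morph lam b : y / - y}.
Proof. by move=> y; apply/eqP; rewrite -addr_eq0 -lamD addNr lam0. Qed.

Lemma lamMn b y n : lam b (y *+ n) = lam b y *+ n.
Proof. by elim: n => [|n IHn]; rewrite ?mulr0n ?lam0 // !mulrS lamD IHn. Qed.

Lemma lam_one y : lam 0 y = y.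
Proof. by rewrite -brace_one /lam mul1g brace_one subr0. Qed.

Lemma lamM a b y : lam (a * b)%g y = lam a (lam b y).
Proof.
by rewrite [lam b y]/lam lamD lamN /lam mulgA opprB addrA subrK.
Qed.

Lemma lam_inj b : injective (lam b).
Proof. by move=> y z /addIr /mulgI. Qed.
End Lambda.

Lemma brace_morph_lam (A B : leftBraceType) (f : A -> B) :
  {morph f : x y / x + y} -> {morph f : x y / (x * y)%g} ->
  forall b y, f (lam b y) = lam (f b) (f y).
Proof.
by move=> fD fM b y; apply: (addrI (f b));
  rewrite -fD -!brace_mulE fM.
Qed.

(** * Primary components of the additive group *)

Lemma mulrn_coprime (V : zmodType) (y : V) m n :
  coprime m n -> y *+ m = 0 -> y *+ n = 0 -> y = 0.
Proof.
have [->|m0] := posnP m; first by rewrite /coprime gcd0n => /eqP->.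
case/(coprimeP _ m0) => -[u v] /= uv ym yn.
have {uv}uv : (u * m = v * n + 1)%N.
  by rewrite addnC -uv subnK // ltnW // -subn_gt0 uv.
have := congr1 (fun k => y *+ k) uv.
by rewrite /= mulrnDr !mulrnA (mulrnAC y u) (mulrnAC y v) ym yn !mul0rn add0r.
Qed.

Lemma mulrn_modn (V : zmodType) (y : V) m n : y *+ n = 0 ->
  y *+ (m %% n) = y *+ m.
Proof.
by move=> yn;
  rewrite {2}(divn_eq m n) mulrnDr mulrnA mulrnAC yn mul0rn add0r.
Qed.

Lemma mulrn_ZpD (V : zmodType) (y : V) n (i j : 'Z_n) :
  y *+ (Zp_trunc n).+2 = 0 -> y *+ (i + j)%R = y *+ i + y *+ j.
Proof. by move=> yn; rewrite -mulrnDr -[RHS](mulrn_modn _ yn). Qed.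

Lemma mulrn_ZpM (V : zmodType) (y : V) n (i j : 'Z_n) :
  y *+ (Zp_trunc n).+2 = 0 -> y *+ (i * j)%R = y *+ i *+ j.
Proof. by move=> yn; rewrite -mulrnA -[RHS](mulrn_modn _ yn). Qed.

Lemma mulrn_Zp_inj (V : zmodType) (y : V) p (a b : 'Z_p) :
  prime p -> y *+ p = 0 -> y != 0 -> y *+ a = y *+ b -> a = b.
Proof.
move=> pr_p yp y0 yab; apply/eqP; rewrite -subr_eq0; apply: contraNT y0 => d0.
have yp' : y *+ (Zp_trunc p).+2 = 0 by rewrite Zp_cast ?prime_gt1.
apply/eqP/(@mulrn_coprime _ _ p (a - b)%R) => //.
  rewrite prime_coprime // gtnNdvd ?lt0n //.
  by have := ltn_ord (a - b); rewrite [X in (_ < X)%N]Zp_cast ?prime_gt1.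
by apply: (addIr (y *+ b)); rewrite add0r -(mulrn_ZpD _ _ yp') subrK.
Qed.

Lemma mulrn_invert (V : zmodType) (y : V) p d : prime p -> y *+ p = 0 ->
  y *+ d != 0 -> exists m, y *+ d *+ m = y.
Proof.
move=> pr_p yp yd.
have d0 : (0 < d)%N by case: d yd => //; rewrite mulr0n eqxx.
have /(coprimeP _ d0)[[u v] /= uv] : coprime d p.
  rewrite coprime_sym prime_coprime //; apply: contra yd => /dvdnP[q ->].
  by rewrite mulrnA mulrnAC yp mul0rn.
exists u; have {uv}uv : (d * u = p * v + 1)%N.
  by rewrite mulnC [(p * v)%N]mulnC addnC -uv subnK // ltnW // -subn_gt0 uv.
by rewrite -mulrnA uv mulrnDr mulrnA yp mul0rn add0r.
Qed.

(** Generators of the primary components of Z_p x Z_6 x Z_2; when p is prime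
to 6, their orders make the components independent. *)
Definition primary_generators p (V : zmodType) (x e f c : V) :=
  [/\ [/\ x *+ p = 0, e *+ 2 = 0, f *+ 2 = 0 & c *+ 3 = 0],
      x != 0 /\ c != 0, [/\ e != 0, f != 0 & e != f] &
      forall y, exists a v k,
        v \in [:: 0; e; f; e + f] /\ y = x *+ a + v + c *+ k].

Lemma primary_generators_Zp62 p : (1 < p)%N ->
  primary_generators p ((1, 0, 0) : 'Z_p * 'Z_6 * 'Z_2)
    (0, inZp 3, 0) (0, 0, 1) (0, inZp 2, 0).
Proof.
move=> p1; split=> //.
  split; rewrite !pairMnE /= ?mul0rn ?Zp_mulrn_char //;
  by rewrite Zp_mulrn; congr (_, _, _); apply: val_inj.
(* 3 u + 2 (2 u) = u in Z_6. *)
move=> [[a u] t]; exists (val a), (0, inZp (3 * u), t), (2 * u)%N; split.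
  by rewrite !inE; case: u t => [[|[|[|[|[|[|//]]]]]] ?] [[|[|//]] ?].
rewrite !pairMnE /= !mul0rn natr_Zp; congr (_, _, _) => /=;
  rewrite ?addr0 ?add0r //.
by rewrite Zp_mulrn; case: u => [[|[|[|[|[|[|//]]]]]] ?]; apply/eqP.
Qed.

Lemma primary_generators_transport p (V W : zmodType) (g : V -> W) x e f c :
  bijective g -> {morph g : y z / y + z} ->
  primary_generators p x e f c -> primary_generators p (g x) (g e) (g f) (g c).
Proof.
move=> gb gD; have gI := bij_inj gb.
have g0 : g 0 = 0 by apply: (addrI (g 0)); rewrite -gD !addr0.
have gMn y n : g (y *+ n) = g y *+ n.
  by elim: n => [|n IHn]; rewrite ?mulr0n ?g0 // !mulrS gD IHn.
have gE y z : (g y == g z) = (y == z) by apply: inj_eq.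
move=> [[x0 e0 f0 c0] [x1 c1] [e1 f1 ef] gen]; split.
- by rewrite -!gMn x0 e0 f0 c0 !g0.
- by rewrite -!g0 !gE.
- by rewrite -!g0 !gE.
case: gb => h gK hK y; have [a [v [k [vV yE]]]] := gen (h y).
exists a, (g v), k; split; last by rewrite -!gMn -!gD -yE hK.
by rewrite -g0 -gD !inE !gE; rewrite !inE in vV.
Qed.

Lemma additive_iso_generators p (V : zmodType) : (1 < p)%N ->
  additive_isomorphic V ('Z_p * 'Z_6 * 'Z_2)%type ->
  exists x e f c : V, primary_generators p x e f c.
Proof.
move=> p1 [h hb hD]; case: hb (hb) => g hK gK hb.
have gb : bijective g by exists h.
have gD : {morph g : y z / y + z}.
  by move=> y z; apply: (can_inj hK); rewrite hD !gK.
by do 4!eexists;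
  apply: primary_generators_transport gb gD (primary_generators_Zp62 p1).
Qed.

Section Torsion.
Variables (p : nat) (V : zmodType) (x e f c : V).
Hypotheses (p6 : coprime p 6) (gen : primary_generators p x e f c).

Let p2 : coprime p 2.
Proof.
by move: p6; rewrite (coprimeMr p 2 3) => /andP[].
Qed.
Let p3 : coprime p 3.
Proof.
by move: p6; rewrite (coprimeMr p 2 3) => /andP[].
Qed.

Lemma Klein_torsion v : v \in [:: 0; e; f; e + f] -> v *+ 2 = 0.
Proof.
case: gen => -[_ e2 f2 _] _ _ _.
by rewrite !inE => /or4P[] /eqP->; rewrite ?mul0rn // mulrnDl e2 f2 addr0.
Qed.

Lemma torsion_p y : y *+ p = 0 -> exists a, y = x *+ a.
Proof.
move=> yp;
  case: (gen) => -[xp _ _ c3] _ _ /(_ y)[a [v [k [/Klein_torsion v2 yE]]]].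
exists a; apply/eqP; rewrite -subr_eq0; apply/eqP.
apply: (mulrn_coprime p6); first by rewrite mulrnBl yp -mulrnAC xp mul0rn subr0.
rewrite yE -(addrA (x *+ a)) (addrC (x *+ a)) addrK mulrnDl (mulrnA v 2 3) v2
  mul0rn add0r.
by rewrite mulrnAC (mulrnA c 3 2) c3 !mul0rn.
Qed.

Lemma torsion_2 y : y *+ 2 = 0 -> y \in [:: 0; e; f; e + f].
Proof.
move=> y2; case: (gen) => -[xp _ _ c3] _ _ /(_ y)[a [v [k [vV yE]]]].
suff -> : y = v by [].
apply/eqP; rewrite -subr_eq0; apply/eqP.
apply: (@mulrn_coprime _ _ 2 (p * 3)).
- by rewrite coprimeMr coprime_sym p2.
- by rewrite mulrnBl y2 (Klein_torsion vV) subr0.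
rewrite yE addrAC addrK mulrnDl mulrnAC mulrnA xp !mul0rn add0r.
by rewrite mulrnAC mulnC mulrnA c3 !mul0rn.
Qed.

Lemma torsion_3 y : y *+ 3 = 0 -> exists k, y = c *+ k.
Proof.
move=> y3;
  case: (gen) => -[xp _ _ c3] _ _ /(_ y)[a [v [k [/Klein_torsion v2 yE]]]].
exists k; apply/eqP; rewrite -subr_eq0; apply/eqP.
apply: (@mulrn_coprime _ _ 3 (p * 2)).
- by rewrite coprimeMr coprime_sym p3.
- by rewrite mulrnBl y3 mulrnAC c3 mul0rn subr0.
rewrite yE addrK mulrnDl mulrnAC mulrnA xp !mul0rn add0r.
by rewrite mulnC mulrnA v2 !mul0rn.
Qed.

(** The 2-torsion has at most four elements, so the four listed ones exhaust
it. *)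
Lemma Klein_span (y z w : V) : y *+ 2 = 0 -> z *+ 2 = 0 -> w *+ 2 = 0 ->
  y != 0 -> z != 0 -> y != z -> w \in [:: 0; y; z; y + z].
Proof.
move=> y2 z2 w2 y0 z0 yz.
have uniq4 : uniq [:: 0; y; z; y + z].
  have yzy : y != y + z by rewrite -{1}[y]addr0 (inj_eq (addrI y)) eq_sym.
  have yzz : z != y + z by rewrite -{1}[z]add0r (inj_eq (addIr z)) eq_sym.
  have yz0 : y + z != 0.
    apply: contraNneq yz => yz0; apply/eqP.
    by rewrite -[RHS]add0r -yz0 -addrA -mulr2n z2 addr0.
  by rewrite /= !inE !negb_or yz yzy yzz !(eq_sym (0 : V)) y0 z0 yz0.
have sub4 : {subset [:: 0; y; z; y + z] <= [:: 0; e; f; e + f]}.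
  by apply/allP; rewrite /= !torsion_2 ?mulrnDl ?mul0rn ?y2 ?z2 ?addr0.
have [_ ->] := uniq_min_size uniq4 sub4 isT; exact: torsion_2.
Qed.
End Torsion.

(** * Structure of the braces *)

Section Structure.
Variables (p : nat) (B : finLeftBraceType) (x e f c : B).
Hypotheses (p_prime : prime p) (p6 : coprime p 6).
Hypothesis gen : primary_generators p x e f c.
Hypotheses (B2 : no_index2 B) (B6 : no_order6 B).
Implicit Types b y z v w : B.

Let x_order : x *+ p = 0. Proof. by case: gen => -[]. Qed.
Let e_order : e *+ 2 = 0. Proof. by case: gen => -[]. Qed.
Let c_order : c *+ 3 = 0. Proof. by case: gen => -[]. Qed.
Let x_neq0 : x != 0. Proof. by case: gen => _ []. Qed.
Let c_neq0 : c != 0. Proof. by case: gen => _ []. Qed.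
Let e_neq0 : e != 0. Proof. by case: gen => _ _ []. Qed.

Lemma lam_order b y n : y *+ n = 0 -> lam b y *+ n = 0.
Proof. by move=> yn; rewrite -lamMn yn lam0. Qed.

Lemma lam_eq0 b y : lam b y = 0 -> y = 0.
Proof. by move=> y0; apply: (@lam_inj _ b); rewrite lam0. Qed.

Lemma fix_mul_eq0 b y : (b * y)%g = y -> b = 0.
Proof.
by rewrite -brace_one => /eqP;
  rewrite -{2}[y]mul1g (inj_eq (mulIg y)) => /eqP.
Qed.

(** The automorphism group of C is of order 2 and the multiplicative group has
no nontrivial sign. *)
Lemma lam_fixes_c b : lam b c = c.
Proof.
have cc : - c != c.
  apply: contra_neq c_neq0 => cN; rewrite -[RHS]c_order mulrS mulr2n.
  by rewrite -{4}cN subrr addr0.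
have cases a : lam a c = c \/ lam a c = - c.
  have [k kE] := torsion_3 p6 gen (lam_order a c_order).
  have := mulrn_modn k c_order; rewrite -kE.
  have := @ltn_pmod k 3 isT; case: (k %% 3)%N => [|[|[|//]]] _ kE'.
  - by move/eqP: c_neq0; case; apply: (@lam_eq0 a); rewrite -kE'.
  - by left.
  - right; apply/eqP; rewrite -kE' -addr_eq0; apply/eqP.
    by rewrite -mulrSr.
have sM : {morph (fun b => lam b c != c) : a b / (a * b)%g >-> a (+) b}.
  move=> a a'; rewrite /= lamM.
  by case: (cases a) (cases a') => aE [] ->; rewrite ?lamN aE ?opprK ?eqxx ?cc.
by apply/eqP; have /negbFE := B2 sM b.
Qed.

(** An automorphism of the Klein group V fixing exactly one nonzero element is a
transposition of V, and the sign of the action on V is trivial.  An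
automorphism without nonzero fixed point permutes the nonzero elements
cyclically, hence lam^2 = 1 + lam. *)
Lemma lam_V_id_or_fpf b :
  (forall y, y *+ 2 = 0 -> lam b y = y) \/
  (forall y, y *+ 2 = 0 -> lam b (lam b y) = y + lam b y).
Proof.
have [y /and3P[/eqP y2 y0 /eqP yb]|nofix] :=
  pickP [pred y | [&& y *+ 2 == 0, y != 0 & lam b y == y]]; last first.
  right=> y y2; have [->|y0] := eqVneq y 0; first by rewrite !lam0 addr0.
  have lamf z : z *+ 2 = 0 -> z != 0 -> lam b z != z.
    by move=> z2 z0; have := nofix z; rewrite /= z2 z0 eqxx /= => ->.
  have y'0 : lam b y != 0 by apply: contra_neq y0; apply: lam_eq0.
  have y'2 := lam_order b y2.
  have := Klein_span p6 gen y2 y'2 (lam_order b y'2) y0 y'0.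
  rewrite eq_sym lamf // => /(_ isT); rewrite !inE => /or4P[] /eqP yE //.
  - by have := lam_eq0 yE => /eqP; rewrite (negPf y'0).
  - have s0 : y + lam b y != 0.
      apply: contraNneq (lamf y y2 y0) => s0.
      by rewrite -[y in X in _ == X]addr0 -(lam_order b y2) mulr2n addrA s0
        add0r.
    have := lamf _ _ s0; rewrite lamD yE addrC eqxx mulrnDl y2 y'2 addr0.
    by move=> /(_ erefl).
  - by have := lamf _ y'2 y'0; rewrite yE eqxx.
left=> z z2; apply/eqP; apply: contraT => zb.
have z0 : z != 0 by apply: contraNneq zb => ->; rewrite lam0.
have zy : z != y by apply: contraNneq zb => ->; rewrite yb.
have span w (w2 : w *+ 2 = 0) := Klein_span p6 gen y2 z2 w2 y0 z0.
rewrite eq_sym zy in span.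
have zE : lam b z = y + z.
  have := span _ (lam_order b z2) isT; rewrite !inE (negPf zb) /=.
  case/or3P=> /eqP // zE.
  - by move: z0; rewrite (lam_eq0 zE) eqxx.
  - by move: zy; rewrite (lam_inj (etrans zE (esym yb))) eqxx.
have yyz : lam b (y + z) = z by rewrite lamD yb zE addrA -mulr2n y2 add0r.
have yz2 : (y + z) *+ 2 = 0 by rewrite mulrnDl y2 z2 addr0.
(* The action on V, extended by the identity to a permutation of B, so that its
   sign is defined. *)
pose t a w := if w *+ 2 == 0 then lam a w else w.
have t_inj a : injective (t a).
  move=> w w'; rewrite /t; case: eqP => [w2|w2]; case: eqP => [w'2|w'2] //.
  - exact: lam_inj.
  - by move=> ww'; case: w'2; rewrite -ww' lam_order.
  - by move=> ww'; case: w2; rewrite ww' lam_order.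
pose s a := odd_perm (perm (t_inj a)).
have sM : {morph s : a a' / (a * a')%g >-> a (+) a'}.
  move=> a a'; rewrite /s addbC -odd_permM; congr (odd_perm _).
  apply/permP=> w; rewrite permM !permE /t.
  case: (w *+ 2 =P 0) => [w2|/eqP/negPf w2]; last by rewrite w2.
  by rewrite lam_order // eqxx lamM.
have := B2 sM b; suff -> : s b by [].
rewrite /s; suff -> : perm (t_inj b) = tperm z (y + z).
  by rewrite odd_tperm -{1}[z]add0r (inj_eq (addIr z)) eq_sym.
apply/permP=> w; rewrite permE /t; case: tpermP => [->|->|wz wyz].
- by rewrite z2 eqxx.
- by rewrite yz2 eqxx.
case: eqP => // w2; have := span _ w2 isT.
by rewrite !inE => /or4P[] /eqP wE //; rewrite wE ?lam0 ?yb.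
Qed.

Lemma lam_V_cube b y : y *+ 2 = 0 -> lam b (lam b (lam b y)) = y.
Proof.
move=> y2; have [idb|fpf] := lam_V_id_or_fpf b; first by rewrite !idb ?idb.
by rewrite fpf ?lam_order // fpf // addrCA -mulr2n lam_order ?addr0.
Qed.

(** Otherwise y = lam v v would solve v * y = y. *)
Lemma lam_V_fixes_V v y : v *+ 2 = 0 -> y *+ 2 = 0 -> lam v y = y.
Proof.
move=> v2 y2; have [idv|fpf] := lam_V_id_or_fpf v; first exact: idv.
suff -> : v = 0 by apply: lam_one.
apply: (@fix_mul_eq0 _ (lam v v)).
by rewrite brace_mulE fpf // addrA -mulr2n v2 add0r.
Qed.

(** If lam x x - x is nonzero, it generates P, and then y = - m x, where
m (lam x x - x) = x, solves x * y = y. *)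
Lemma lam_x_fixes_x : lam x x = x.
Proof.
have [d dE] := torsion_p p6 gen (lam_order x x_order).
have [D0|D0] := eqVneq (lam x x - x) 0.
  by apply/eqP; rewrite -subr_eq0 D0.
have [m mE] : exists m, (lam x x - x) *+ m = x.
  have Dp : (lam x x - x) *+ p = 0.
    by rewrite mulrnBl lam_order ?x_order // subr0.
  have [d' d'E] := torsion_p p6 gen Dp.
  by rewrite d'E; apply: (mulrn_invert p_prime x_order); rewrite -d'E.
have : x = 0; last by move/eqP: x_neq0.
apply: (@fix_mul_eq0 _ (- (x *+ m))).
by rewrite brace_mulE lamN lamMn -{1}mE mulrnBl addrAC subrr add0r.
Qed.

(** On the multiples of a fixed point b of lam b the two group laws agree, so
multiples of b are its multiplicative powers. *)
Lemma lam_mulrn b k y : lam b b = b -> lam (b *+ k) y = iter k (lam b) y.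
Proof.
move=> bb; elim: k => [|k IHk]; first exact: lam_one.
by rewrite iterS -IHk -lamM brace_mulE lamMn bb mulrS.
Qed.

(** The p-th power of lam x is trivial, while its cube is trivial on V. *)
Lemma lam_x_fixes_V y : y *+ 2 = 0 -> lam x y = y.
Proof.
move=> y2; have [idx|fpf] := lam_V_id_or_fpf x; first exact: idx.
have yp : iter (p %% 3) (lam x) y = y.
  rewrite iter_modn; last by rewrite /= lam_V_cube.
  by rewrite -lam_mulrn ?lam_x_fixes_x // x_order lam_one.
have : (p %% 3)%N != 0%N.
  have p3 : coprime p 3 by move: p6; rewrite (coprimeMr p 2 3) => /andP[].
  by apply: contraL p3 => p3; rewrite coprime_sym prime_coprime // negbK /dvdn.
have := @ltn_pmod p 3 isT; case: (p %% 3)%N yp => [|[|[|//]]] //= yp _ _.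
by have := fpf y y2; rewrite yp => /eqP;
  rewrite eq_sym -subr_eq0 addrAC subrr add0r => /eqP/lam_eq0->; rewrite lam0.
Qed.

(** If c acted trivially on V, it would commute with the involution e. *)
Lemma lam_c_on_V y : y *+ 2 = 0 -> lam c (lam c y) = y + lam c y.
Proof.
have [idc|fpf] := lam_V_id_or_fpf c; last exact: fpf.
case: (B6 (x := e) (y := c)); rewrite /cube_trivial.
- by rewrite brace_mulE lam_V_fixes_V // -mulr2n e_order brace_one.
- by rewrite !brace_mulE !(lamD, lam_fixes_c) brace_one -c_order !mulrS mulr0n
  addr0.
- by rewrite !brace_mulE lam_fixes_c idc // addrC.
- by rewrite brace_one => /eqP; rewrite (negPf e_neq0).
- by rewrite brace_one => /eqP; rewrite (negPf c_neq0).
Qed.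

(** Conjugation by c maps v to lam c v, so these act on P in the same way.  As V
acts trivially on itself, v * lam c v = v + lam c v = lam c (lam c v) acts on P
as v does; hence lam c v acts trivially, and so does v. *)
Lemma lam_V_fixes_x v : v *+ 2 = 0 -> lam v x = x.
Proof.
have conj w : w *+ 2 = 0 -> lam (lam c w) x = lam w x.
  move=> w2; apply: (@lam_inj _ c).
  have [r rE] := torsion_p p6 gen (lam_order (lam c w) x_order).
  have [u uE] := torsion_p p6 gen (lam_order c x_order).
  have cw : (c * w = lam c w * c)%g by rewrite !brace_mulE lam_fixes_c addrC.
  by rewrite -[RHS]lamM cw lamM rE lamMn uE !lamMn rE mulrnAC.
move=> v2; apply/esym; apply: (@lam_inj _ (lam c v)).
rewrite {1}conj // -lamM brace_mulE (lam_V_fixes_V (lam_order c v2) v2) addrC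
  -lam_c_on_V //.
by rewrite !conj ?lam_order.
Qed.

Lemma lam_trivial b :
  lam b x = x -> (forall v, v *+ 2 = 0 -> lam b v = v) -> lam b =1 id.
Proof.
move=> bx bV y; case: gen => _ _ _ /(_ y)[a [v [k [vV ->]]]].
by rewrite !lamD !lamMn bx lam_fixes_c bV // (Klein_torsion gen vV).
Qed.

Lemma lam_x_id a : lam (x *+ a) =1 id.
Proof.
move=> y; rewrite lam_mulrn ?lam_x_fixes_x //; elim: a => //= a ->.
by apply: lam_trivial; [apply: lam_x_fixes_x | apply: lam_x_fixes_V].
Qed.

Lemma lam_v_id v : v *+ 2 = 0 -> lam v =1 id.
Proof.
by move=> v2; apply: lam_trivial; [apply: lam_V_fixes_x | move=> w;
  apply: lam_V_fixes_V].
Qed.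

(** The three components of an element multiply to it, and the first two act
trivially. *)
Lemma lam_decomp a v k : v *+ 2 = 0 ->
  lam (x *+ a + v + c *+ k) =1 iter k (lam c).
Proof.
move=> v2 y; rewrite -lam_mulrn ?lam_fixes_c //.
suff -> : x *+ a + v + c *+ k = (x *+ a * (v * (c *+ k)))%g.
  by rewrite !lamM lam_x_id lam_v_id.
by rewrite !brace_mulE lam_x_id lam_v_id // addrA.
Qed.

End Structure.

(** * The model braces *)

Section Model.
Variables (p : nat) (zeta : {unit 'Z_p}).
Hypothesis zeta3 : (zeta ^+ 3 = 1)%g.

Let kchar (b : B12) := (zeta ^+ val b.2)%g.

Let kcharM : {morph kchar : a b / (a * b)%g}.
Proof. by move=> a b; rewrite /kchar -expgD -[RHS](expg_mod _ zeta3). Qed.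

Definition model_char : {morphism [set: B12] >-> {unit 'Z_p}} :=
  Morphism (in2W kcharM).

(** The semidirect product of Z_p and F_4 : Z_3 in which (v, i) acts on Z_p as
zeta^i. *)
Definition model : finLeftBraceType := Zsdprod model_char.

Lemma model_lamE (q r : model) :
  lam q r = (val (zeta ^+ val q.2.2)%g * r.1, (iter q.2.2 omega r.2.1, r.2.2)).
Proof.
by apply: (addrI q); rewrite -brace_mulE.
Qed.

(** The Chinese remainder theorem: (s, k) |-> 3 s + 4 k identifies Z_2 x Z_3
with Z_6. *)
Lemma model_add_iso : additive_isomorphic model ('Z_p * 'Z_6 * 'Z_2)%type.
Proof.
pose g (i : 'Z_2) (k : 'Z_3) : 'Z_6 := inZp (3 * i + 4 * k).
pose h (u : 'Z_6) : 'Z_2 * 'Z_3 := (inZp u, inZp u).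
have gK i k : h (g i k) = (i, k).
  by case: i k => [[|[|//]] ?] [[|[|[|//]]] ?]; congr (_, _); apply: val_inj.
have hK u : g (h u).1 (h u).2 = u.
  by case: u => [[|[|[|[|[|[|//]]]]]] ?]; apply: val_inj.
have gD i i' k k' : g (i + i') (k + k') = g i k + g i' k'.
  by case: i i' k k' =>
    [[|[|//]] ?] [[|[|//]] ?] [[|[|[|//]]] ?] [[|[|[|//]]] ?]; apply: val_inj.
exists (fun q : model => (q.1, g q.2.1.1 q.2.2, q.2.1.2)); last first.
  by move=> q r; congr (_, _, _); apply: gD.
exists (fun t => (t.1.1, ((h t.1.2).1, t.2, (h t.1.2).2)) : model).
  by move=> [a [[i j] k]];
    rewrite -[LHS]/(a, ((h (g i k)).1, j, (h (g i k)).2)) gK.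
by move=> [[a u] t]; rewrite -[LHS]/(a, g (h u).1 (h u).2, t) hK.
Qed.

Lemma model_mul_iso : exists tau : {morphism [set: A4] >-> {unit 'Z_p}},
  [set: model] \isog [set: Zsdprod tau].
Proof.
have [h [h' hK h'K] hM] := B12_A4.
have tM : {morph (fun g => model_char (h g)) : a b / (a * b)%g}.
  by move=> a b; rewrite hM morphM ?inE.
exists (Morphism (in2W tM)); apply/isog_bij.
exists (fun q : model => (q.1, h' q.2)).
  exists (fun q => (q.1, h q.2)); first by move=> [a b]; rewrite /= h'K.
  by move=> [a b]; rewrite /= hK.
move=> q r; congr (_, _); last first.
  by apply: (can_inj hK); rewrite hM !h'K.
by rewrite /= h'K.
Qed.

Lemma model_in_class : add_Zp62_mul_ZpA4 p model.
Proof. by split; [apply: model_add_iso | apply: model_mul_iso]. Qed.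

Variables (B : finLeftBraceType) (x e f c : B).
Hypotheses (p_prime : prime p) (p6 : coprime p 6).
Hypothesis gen : primary_generators p x e f c.
Hypotheses (B2 : no_index2 B) (B6 : no_order6 B).
Hypothesis cardB : #|B| = (12 * p)%N.
Hypothesis cx : lam c x = x *+ val (val zeta).

(** The pair (e, lam c e) serves as the basis (1, omega) of V. *)
Let phi (q : model) :=
  x *+ q.1 + (e *+ q.2.1.1 + lam c e *+ q.2.1.2) + c *+ q.2.2.

Lemma phiD : {morph phi : q r / q + r}.
Proof.
case: gen => -[xp e2 _ c3] _ _ _.
have xp' : x *+ (Zp_trunc p).+2 = 0 by rewrite Zp_cast ?prime_gt1.
move=> q r; rewrite /phi (mulrn_ZpD _ _ xp') (@mulrn_ZpD _ e 2 _ _ e2).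
rewrite (@mulrn_ZpD _ c 3 _ _ c3) (@mulrn_ZpD _ _ 2 _ _ (lam_order c e2)).
by rewrite [RHS]addrACA; congr (_ + _); rewrite [RHS]addrACA; congr (_ + _);
  rewrite addrACA.
Qed.

Lemma lam_c_phi q : lam c (phi q) = phi (val zeta * q.1, (omega q.2.1, q.2.2)).
Proof.
case: gen => -[xp e2 _ c3] _ _ _.
have xp' : x *+ (Zp_trunc p).+2 = 0 by rewrite Zp_cast ?prime_gt1.
rewrite /phi !lamD !lamMn cx (lam_fixes_c p6 gen B2) (lam_c_on_V p6 gen B2 B6)
  //=.
congr (_ + _ + _); first by rewrite (mulrn_ZpM _ _ xp').
by rewrite [(e + _) *+ _]mulrnDl (mulrn_modn _ (lam_order c e2)) mulrnDr addrCA.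
Qed.

Lemma phiM : {morph phi : q r / (q * r)%g}.
Proof.
have V2 (q : model) : (e *+ q.2.1.1 + lam c e *+ q.2.1.2) *+ 2 = 0.
  case: gen => -[_ e2 _ _] _ _ _.
  by rewrite mulrnDl !(mulrnAC _ _ 2) lam_order // e2 !mul0rn addr0.
move=> q r.
have key k : phi (val (zeta ^+ k)%g * r.1, (iter k omega r.2.1, r.2.2)) =
             iter k (lam c) (phi r).
  elim: k => [|k IHk].
    by case: r => a [v j]; rewrite expg0 FinRing.val_unit1 mul1r.
  by rewrite !iterS -IHk lam_c_phi expgS FinRing.val_unitM -mulrA.
rewrite [RHS]brace_mulE {2}/phi (lam_decomp p_prime p6 gen B2 B6 _ _ (V2 q)).
rewrite -[(q * r)%g]/
  (q + (val (zeta ^+ val q.2.2)%g * r.1,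
        (iter q.2.2 omega r.2.1, r.2.2)) : model).
rewrite phiD; congr (_ + _); exact: key.
Qed.

Lemma phi_surj y : exists q, phi q = y.
Proof.
case: (gen) => -[xp e2 f2 c3] [x0 c0] [e0 f0 ef] /(_ y)[a [v [k [vV ->]]]].
have lame0 : lam c e != 0 by apply: contra_neq e0; apply: lam_eq0.
have elame : e != lam c e.
  apply: contraNneq e0 => ee; have := lam_c_on_V p6 gen B2 B6 e2.
  by rewrite -!ee => /eqP; rewrite -{1}[e]addr0 (inj_eq (addrI e)) eq_sym.
have [w <-] : exists w : 'Z_2 * 'Z_2, e *+ w.1 + lam c e *+ w.2 = v; last first.
  exists (inZp a, (w, inZp k)); rewrite /phi /= (mulrn_modn _ c3).
  by rewrite mulrn_modn // Zp_cast ?prime_gt1.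
have := Klein_span p6 gen e2 (lam_order c e2) (Klein_torsion gen vV) e0 lame0
  elame.
rewrite !inE => /or4P[] /eqP->.
- by exists (0, 0); rewrite addr0.
- by exists (1, 0); rewrite addr0.
- by exists (0, 1); rewrite add0r.
- by exists (1, 1).
Qed.

(** A surjective homomorphism between braces of the same order 12 p is an
isomorphism. *)
Lemma brace_iso_model : brace_isomorphic B model.
Proof.
have phi_surjb y : exists q, phi q == y.
  by have [q <-] := phi_surj y; exists q.
pose g y := xchoose (phi_surjb y).
have gK : cancel g phi by move=> y; apply/eqP/(xchooseP (phi_surjb y)).
have [|g' _ g'K] := inj_card_bij (can_inj gK).
  by rewrite cardB !card_prod !card_ord Zp_cast ?prime_gt1 // mulnC.
have phiE : phi =1 g' by move=> q; rewrite -{1}[q]g'K gK.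
have phiK : cancel phi g by move=> q; rewrite phiE g'K.
exists g; split; first by exists phi.
- by move=> y z; apply: (can_inj phiK); rewrite phiD !gK.
- by move=> y z; apply: (can_inj phiK); rewrite phiM !gK.
Qed.
End Model.

(** * Classification *)

Lemma brace_isomorphic_refl (B : leftBraceType) : brace_isomorphic B B.
Proof. by exists id; split=> //; exists id. Qed.

(** The change of generator of C that replaces zeta by its square. *)
Lemma generators_double p (V : zmodType) (x e f c : V) :
  primary_generators p x e f c -> primary_generators p x e f (c *+ 2).
Proof.
move=> [[xp e2 f2 c3] [x0 c0] ef gen]; split=> //.
- by split; rewrite // mulrnAC c3 mul0rn.
- split=> //; apply: contra_neq c0 => c2.
  by rewrite -[RHS]c3 mulrS c2 addr0.
move=> y; have [a [v [k [vV yE]]]] := gen y; exists a, v, (2 * k)%N; split=> //.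
by rewrite yE -mulrnA mulnA (mulrnA _ 4) (mulrS c 3) c3 addr0.
Qed.

Lemma B12_mulrn6 (a : B12) : a *+ 6 = 0.
Proof.
have Z6 n (i : 'Z_n) : (1 < n)%N -> (n %| 6)%N -> i *+ 6 = 0.
  by move=> n1 /dvdnP[d ->]; rewrite mulrnA mulrnAC Zp_mulrn_char // mul0rn.
by case: a => -[s t] i; rewrite !pairMnE /= !Z6.
Qed.

Lemma unit1_cube p : ((1 : {unit 'Z_p}) ^+ 3 = 1)%g.
Proof. exact: expg1n. Qed.

Section Classification.
Variable p : nat.
Hypotheses (p_prime : prime p) (p_ge7 : (7 <= p)%N).

Let p_gt1 : (1 < p)%N. Proof. exact: prime_gt1. Qed.

Let p6 : coprime p 6.
Proof.
by rewrite (coprimeMr p 2 3) !prime_coprime // !gtnNdvd // (leq_trans _ p_ge7).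
Qed.

(** The root of unity zeta is defined by the action of c on P.  The generators c
and 2c give the two values zeta and zeta^2. *)
Lemma class_normal_form (B : finLeftBraceType) : add_Zp62_mul_ZpA4 p B ->
  exists zeta : {unit 'Z_p}, (zeta ^+ 3 = 1)%g /\
    forall zeta' (zeta'3 : (zeta' ^+ 3 = 1)%g),
      zeta' = zeta \/ zeta' = (zeta ^+ 2)%g ->
        brace_isomorphic B (model zeta'3).
Proof.
move=> [hadd [tau /isog_bij[h hb hM]]].
have p_odd : odd p by case: (even_prime p_prime) p_ge7 => // ->.
have p3 : coprime p 3 by move: p6; rewrite (coprimeMr p 2 3) => /andP[].
have B2 : no_index2 B.
  exact: no_index2_iso hb hM (Zsdprod_no_index2 p_gt1 p_odd A4_no_index2).
have B6 : no_order6 B.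
  exact: no_order6_inj (bij_inj hb) hM (Zsdprod_no_order6 p_gt1 p_odd p3
    A4_no_order6).
have cardB : #|B| = (12 * p)%N.
  have [g /bij_eq_card -> _] := hadd.
  by rewrite !card_prod !card_ord Zp_cast // -mulnA mulnC.
have [x [e [f [c gen]]]] := additive_iso_generators p_gt1 hadd.
case: (gen) => -[xp _ _ c3] [x0 _] _ _.
have [u uE] := torsion_p p6 gen (lam_order c xp).
have u_unit : (u%:R : 'Z_p) \is a GRing.unit.
  rewrite unitZpE // prime_coprime //; apply: contra x0 => /dvdnP[q uq].
  by apply/eqP/(@lam_eq0 _ c); rewrite uE uq mulrnA mulrnAC xp mul0rn.
pose zeta : {unit 'Z_p} := FinRing.unit 'Z_p u_unit.
have zetaE : lam c x = x *+ val (val zeta).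
  by rewrite uE /= val_Zp_nat // mulrn_modn.
have iter_zeta k : iter k (lam c) x = x *+ val (val (zeta ^+ k)%g).
  elim: k => [|k IHk]; first by rewrite expg0 FinRing.val_unit1.
  rewrite iterS IHk lamMn zetaE expgS FinRing.val_unitM.
  by rewrite mulrn_ZpM // Zp_cast.
have zeta3 : (zeta ^+ 3 = 1)%g.
  apply: val_inj; apply: (mulrn_Zp_inj p_prime xp x0).
  by rewrite -iter_zeta -(lam_mulrn _ _ (lam_fixes_c p6 gen B2 c)) c3 lam_one.
exists zeta; split=> // zeta' zeta'3 [] zE.
  apply: (brace_iso_model zeta'3 p_prime p6 gen B2 B6 cardB).
  by rewrite zE.
apply: (brace_iso_model zeta'3 p_prime p6 (generators_double gen) B2 B6 cardB).
by rewrite (lam_mulrn _ _ (lam_fixes_c p6 gen B2 c)) iter_zeta zE.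
Qed.

Lemma card_unit_prime : #|[set: {unit 'Z_p}]| = p.-1.
Proof. by rewrite (card_units_Zp (ltnW p_gt1)) totient_prime. Qed.

Lemma unit_cube_order (zeta : {unit 'Z_p}) :
  (zeta ^+ 3 = 1)%g -> zeta != 1%g -> #[zeta]%g = 3%N.
Proof.
move/eqP; rewrite -order_dvdn => o3; rewrite -order_eq1.
have : #[zeta]%g \in divisors 3 by rewrite -dvdn_divisors.
by rewrite !inE => /orP[] /eqP->.
Qed.

Lemma dvd3_pred : (3 %| p.-1)%N = (p == 1 %[mod 3])%N.
Proof. by rewrite eqn_mod_dvd ?subn1 ?prime_gt0. Qed.

Lemma unit_cube_trivial (zeta : {unit 'Z_p}) :
  (p != 1 %[mod 3])%N -> (zeta ^+ 3 = 1)%g -> zeta = 1%g.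
Proof.
move=> p13 z3; apply/eqP; apply: contraNT p13 => z1.
rewrite -dvd3_pred -(unit_cube_order z3 z1) -card_unit_prime.
by apply: order_dvdG; rewrite inE.
Qed.

Lemma unit_cube_power (zeta zeta' : {unit 'Z_p}) :
  #[zeta]%g = 3%N -> #[zeta']%g = 3%N -> zeta' = zeta \/ zeta' = (zeta ^+ 2)%g.
Proof.
move=> o3 o3'; have : zeta' \in <[zeta]>%g.
  suff -> : <[zeta]>%g = <[zeta']>%g by apply: cycle_id.
  apply/eqP; rewrite (eq_subG_cyclic (units_Zp_cyclic p_prime)) ?subsetT //.
  by rewrite -!orderE o3 o3'.
case/cyclePmin=> i; rewrite o3; case: i => [|[|[|//]]] _ zE.
- by move: o3'; rewrite zE order1.
- by left.
- by right.
Qed.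

Lemma model_one_direct : is_direct_product p (model (unit1_cube p)).
Proof.
exists B12, (model_char (unit1_cube p)); split; first exact: card_B12.
  exact: brace_isomorphic_refl.
by move=> b; apply: expg1n.
Qed.

Section Primitive.
Variable zeta : {unit 'Z_p}.
Hypotheses (zeta3 : (zeta ^+ 3 = 1)%g) (zeta_order : #[zeta]%g = 3%N).

Lemma model_kernel : has_kernel p (model zeta3) V4.
Proof.
exists B12, (model_char zeta3); split; first exact: card_B12.
  exact: brace_isomorphic_refl.
rewrite isog_sym.
pose i (v : V4) : B12 := (v, 0).
have iM : {morph i : v w / (v * w)%g}.
  by move=> v w; rewrite mulB12E [X in (_, X)]addr0.
apply/isogP; exists (Morphism (in2W iM)).
  by apply/injmP => v w _ _ [].
apply/setP=> -[v k]; apply/morphimP/idP.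
  by case=> w _ _ [-> ->]; apply/kerP; rewrite ?inE.
move/kerP; rewrite inE => /(_ isT) /= /eqP;
  rewrite -order_dvdn zeta_order => k0.
exists v; rewrite ?inE //=; congr (_, _); apply: val_inj => /=.
by case: k k0 => [[|[|[|//]]] ?].
Qed.

(** A brace isomorphism transports the action on the p-torsion, which is trivial
on one side and multiplication by zeta on the other. *)
Lemma model_not_iso : ~ brace_isomorphic (model (unit1_cube p)) (model zeta3).
Proof.
move=> [f [fb fD fM]]; have fI := bij_inj fb; case: fb => g gK fK.
pose q : model zeta3 := (0, (0, 1)); pose y : model zeta3 := (1, 0).
have f0 : f 0 = 0 by apply: (addrI (f 0)); rewrite -fD !addr0.
have fMn z n : f (z *+ n) = f z *+ n.
  by elim: n => [|n IHn]; rewrite ?mulr0n ?f0 // !mulrS fD IHn.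
have yp : y *+ p = 0 by rewrite pairMnE Zp_mulrn_char // mul0rn.
have gyp : g y *+ p = 0 by apply: fI; rewrite fMn fK yp f0.
have gy2 : (g y).2 = 0.
  apply: (mulrn_coprime p6); first by have := congr1 snd gyp; rewrite pairMnE.
  exact: B12_mulrn6.
have lamy : lam (g q) (g y) = g y.
  rewrite model_lamE gy2 [X in val X]expg1n FinRing.val_unit1 mul1r iter_omega0.
  by rewrite [RHS]surjective_pairing gy2.
have := congr1 fst (congr1 f lamy);
  rewrite brace_morph_lam // !fK model_lamE /= mulr1 => z1.
have : zeta = 1%g by apply: val_inj.
by move=> zE; have := zeta_order; rewrite zE order1.
Qed.
End Primitive.

Lemma classification_trivial : (p != 1 %[mod 3])%N ->
  forall B : finLeftBraceType, add_Zp62_mul_ZpA4 p B ->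
  brace_isomorphic B (model (unit1_cube p)).
Proof.
move=> p13 B /class_normal_form[zeta [z3 iso]].
by apply: iso; left; rewrite (unit_cube_trivial p13 z3).
Qed.

Lemma classification_primitive (zeta : {unit 'Z_p})
    (zeta3 : (zeta ^+ 3 = 1)%g) :
  #[zeta]%g = 3%N -> forall B : finLeftBraceType, add_Zp62_mul_ZpA4 p B ->
  brace_isomorphic B (model (unit1_cube p)) \/ brace_isomorphic B (model zeta3).
Proof.
move=> o3 B /class_normal_form[zeta' [z3' iso]].
have [z1|z1] := eqVneq zeta' 1%g; first by left; apply: iso; left.
by right; apply: iso; apply: unit_cube_power => //; apply: unit_cube_order.
Qed.

End Classification.

Theorem proposition15 (p : nat) (p_prime : prime p) (p_ge7 : (7 <= p)%N) :
  ((p != 1 %[mod 3])%N ->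
    exists B : finLeftBraceType,
      [/\ add_Zp62_mul_ZpA4 p B,
          (forall B' : finLeftBraceType,
             add_Zp62_mul_ZpA4 p B' -> brace_isomorphic B' B)
        & is_direct_product p B])
  /\
  ((p == 1 %[mod 3])%N ->
    exists B1 B2 : finLeftBraceType,
      [/\ add_Zp62_mul_ZpA4 p B1 /\ add_Zp62_mul_ZpA4 p B2,
          ~ brace_isomorphic B1 B2,
          (forall B : finLeftBraceType, add_Zp62_mul_ZpA4 p B ->
             brace_isomorphic B B1 \/ brace_isomorphic B B2),
          is_direct_product p B1
        & has_kernel p B2 V4]).
Proof.
split=> [p13|].
  exists (model (unit1_cube p)); split; first exact: model_in_class.
    exact: classification_trivial.
  exact: model_one_direct.
rewrite -dvd3_pred // -card_unit_prime // => /Cauchy[//|zeta _ o3].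
have zeta3 : (zeta ^+ 3 = 1)%g by rewrite -o3 expg_order.
exists (model (unit1_cube p)), (model zeta3); split.
- by split; apply: model_in_class.
- exact: model_not_iso.
- exact: classification_primitive.
- exact: model_one_direct.
- exact: model_kernel.
Qed.
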